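(* For every integer $n\geq 1$, $$F_{3n} = 2T_{n-1}(4) - \sum_{k=1}^{n-2} \bigl(4T_{n-1-k}(4)-2T_{n-2-k}(4)\bigr)F_{3k},$$ $$F_{3n} + 4 F_{3n-3} = 2U_{n-1}(4) -\sum_{k=1}^{n-2}\bigl(4U_{n-1-k}(4)-2U_{n-2-k}(4)\bigr)F_{3k},$$ where, for every integer $n\ge 0$, $$T_{n}(4) = 4^n \sum_{j=0}^{\lfloor n/2\rfloor} \binom{n}{2j}\Bigl(\frac{15}{16}\Bigr)^j \quad\text{and}\quad U_{n}(4) = 4^n \sum_{j=0}^{\lfloor n/2\rfloor} \binom{n+1}{2j+1}\Bigl(\frac{15}{16}\Bigr)^j.$$
   Context: $F_n$ denotes the Fibonacci numbers: $F_0=0$, $F_1=1$, $F_n=F_{n-1}+F_{n-2}$ for $n\geq 2$. The Chebyshev polynomials of the first kind $T_n(x)$ and of the second kind $U_n(x)$ are defined by $T_0(x)=1$, $T_1(x)=x$, $T_{n+1}(x)=2xT_n(x)-T_{n-1}(x)$, and $U_0(x)=1$, $U_1(x)=2x$, $U_{n+1}(x)=2xU_n(x)-U_{n-1}(x)$ for $n\ge 1$; $T_n(4)$, $U_n(4)$ are their values at $x=4$. A sum whose upper limit is smaller than its lower limit is $0$. *)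

(* Defs.v *)
From mathcomp Require Import all_boot all_order all_algebra.

Set Implicit Arguments.
Unset Strict Implicit.
Unset Printing Implicit Defensive.

Import GRing.Theory.
Local Open Scope ring_scope.

Fixpoint fib (n : nat) : nat :=
  match n with
  | 0 => 0
  | m.+1 => match m with
            | 0 => 1
            | k.+1 => fib m + fib k
            end
  end%N.

Fixpoint chebyshevT (R : nzRingType) (n : nat) : {poly R} :=
  match n with
  | 0 => 1
  | m.+1 => match m with
            | 0 => 'X
            | k.+1 => 2 * 'X * chebyshevT R m - chebyshevT R k
            end
  end.

Fixpoint chebyshevU (R : nzRingType) (n : nat) : {poly R} :=
  match n with
  | 0 => 1
  | m.+1 => match m with
            | 0 => 2 * 'X
            | k.+1 => 2 * 'X * chebyshevU R m - chebyshevU R k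
            end
  end.

(* Main.v *)
Require Import Defs.
From mathcomp Require Import all_boot all_order all_algebra.
From mathcomp Require Import ring zify.

Set Implicit Arguments.
Unset Strict Implicit.
Unset Printing Implicit Defensive.

Import GRing.Theory.
Local Open Scope ring_scope.

(** Both convolution identities are one identity, linear in a sequence [P] with
    [P (n + 2) = 8 P (n + 1) - P n]; it follows from
    [F_(3n+6) = 4 F_(3n+3) + F_(3n)] by induction on the length of the sum, the
    step replacing [P] by its shift.  For the closed forms, the even and odd
    halves of the expansion of [(1 + sqrt q) ^ n] satisfy a two-term linear
    system by Pascal's rule; for [q = 15/16] it becomes the Chebyshev recurrence
    at 4 after scaling by [4 ^ n]. *)

Lemma fib3_rec (n : nat) :
  fib (3 * n.+2) = (4 * fib (3 * n.+1) + fib (3 * n))%N.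
Proof.
rewrite (_ : 3 * n.+2 = (3 * n).+4.+2)%N; last by lia.
rewrite (_ : 3 * n.+1 = (3 * n).+3)%N; last by lia.
by rewrite /=; case: (3 * n)%N => [|m] //=; lia.
Qed.

#[local] Arguments fib n : simpl never.

(** The two Fibonacci terms on the right absorb arbitrary initial values of [P], which lets the
    induction hypothesis apply to a shifted sequence. *)
Lemma fib3_convolution (R : comNzRingType) (P : nat -> R) (n : nat) :
  (forall j, P j.+2 = 8 * P j.+1 - P j) ->
  \sum_(1 <= k < n.+1)
     (4 * P (n.+1 - k)%N - 2 * P (n - k)%N) * (fib (3 * k))%:R
  = 2 * P n.+1 - P 0%N * (fib (3 * n.+2))%:R
    - (P 1%N - 4 * P 0%N) * (fib (3 * n.+1))%:R.
Proof.
elim: n P => [|n IHn] P recP.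
  by rewrite big_geq // (_ : fib (3 * 2) = 8) // (_ : fib (3 * 1) = 2) //; ring.
rewrite big_nat_recr //= subnn subSnn.
(* The peeled term [k = n + 1] is the only one using [P 0]. For [k <= n] both indices are
   successors, so the rest is a shorter sum for the shift of [P]. *)
rewrite (eq_big_nat _ _ (F2 := fun k =>
    (4 * P (n.+1 - k).+1 - 2 * P (n - k).+1) * (fib (3 * k))%:R)); last first.
  by move=> k /andP[_ lekn]; rewrite -!subSn //; lia.
rewrite (IHn (fun j => P j.+1) (fun j => recP j.+1)).
rewrite (fib3_rec n.+1) (recP 0%N) natrD natrM; ring.
Qed.

Section BinomialHalves.
Variables (R : comNzRingType) (q : R).

(** The bound [n + 1] avoids halving: the terms with [2 * j > n] are zero. *)
Definition even_binomial_sum (n : nat) : R :=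
  \sum_(0 <= j < n.+1) 'C(n, 2 * j)%:R * q ^+ j.

Definition odd_binomial_sum (n : nat) : R :=
  \sum_(0 <= j < n.+1) 'C(n, 2 * j + 1)%:R * q ^+ j.

Lemma binomial_sum_trunc (n i a b : nat) : (n < 2 * a + i)%N -> (a <= b)%N ->
  \sum_(0 <= j < b) 'C(n, 2 * j + i)%:R * q ^+ j
  = \sum_(0 <= j < a) 'C(n, 2 * j + i)%:R * q ^+ j.
Proof.
move=> lt_na le_ab; rewrite (big_cat_nat (n := a)) //=.
rewrite [X in _ + X]big_nat_cond [X in _ + X]big1 ?addr0 //.
move=> j /andP[/andP[le_aj _] _].
by rewrite bin_small ?mul0r //; lia.
Qed.

Lemma even_binomial_sumE (n b : nat) : (n < 2 * b)%N ->
  \sum_(0 <= j < b) 'C(n, 2 * j)%:R * q ^+ j = even_binomial_sum n.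
Proof.
move=> lt_nb; rewrite /even_binomial_sum.
under eq_bigr do rewrite -[(2 * _)%N]addn0.
under [RHS]eq_bigr do rewrite -[(2 * _)%N]addn0.
by case: (leqP b n.+1) => le_b;
  [apply/esym|]; apply: binomial_sum_trunc; lia.
Qed.

Lemma odd_binomial_sumE (n b : nat) : (n < 2 * b + 1)%N ->
  \sum_(0 <= j < b) 'C(n, 2 * j + 1)%:R * q ^+ j = odd_binomial_sum n.
Proof.
move=> lt_nb; rewrite /odd_binomial_sum.
by case: (leqP b n.+1) => le_b;
  [apply/esym|]; apply: binomial_sum_trunc; lia.
Qed.

Lemma odd_binomial_sumS (n : nat) :
  odd_binomial_sum n.+1 = even_binomial_sum n + odd_binomial_sum n.
Proof.
(* Padding with zero terms gives all three sums the same range, so Pascal's rule applies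
   termwise. *)
rewrite -(@even_binomial_sumE n n.+2) -1?(@odd_binomial_sumE n n.+2) //; try lia.
rewrite -big_split /=; apply: eq_bigr => j _.
by rewrite addn1 binS natrD mulrDl addrC.
Qed.

Lemma even_binomial_sumS (n : nat) :
  even_binomial_sum n.+1 = even_binomial_sum n + q * odd_binomial_sum n.
Proof.
rewrite -(@even_binomial_sumE n n.+2); last by lia.
(* Pascal's rule needs a positive lower index, so the term [j = 0] is split off; the reindexing
   [j + 1] produces the factor [q]. *)
rewrite /even_binomial_sum /odd_binomial_sum !(big_nat_recl n.+1) //= !muln0 !bin0.
rewrite -addrA; congr (_ + _).
rewrite mulr_sumr -big_split /=; apply: eq_bigr => j _.
rewrite (_ : 2 * j.+1 = (2 * j + 1).+1)%N; last by lia.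
by rewrite binS natrD exprS; ring.
Qed.

(** The characteristic polynomial [X^2 - 2 X + (1 - q)] has the roots [1 + sqrt q] and
    [1 - sqrt q]. *)
Lemma even_binomial_sum_rec (n : nat) :
  even_binomial_sum n.+2 = 2 * even_binomial_sum n.+1 - (1 - q) * even_binomial_sum n.
Proof.
by rewrite even_binomial_sumS odd_binomial_sumS even_binomial_sumS; ring.
Qed.

Lemma odd_binomial_sum_rec (n : nat) :
  odd_binomial_sum n.+2 = 2 * odd_binomial_sum n.+1 - (1 - q) * odd_binomial_sum n.
Proof.
by rewrite odd_binomial_sumS even_binomial_sumS odd_binomial_sumS; ring.
Qed.

End BinomialHalves.

Lemma eq_two_step_rec (T : Type) (f : T -> T -> T) (u v : nat -> T) :
  (forall n, u n.+2 = f (u n.+1) (u n)) -> (forall n, v n.+2 = f (v n.+1) (v n)) ->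
  u 0%N = v 0%N -> u 1%N = v 1%N -> u =1 v.
Proof.
move=> uS vS uv0 uv1 n.
suff [] : u n = v n /\ u n.+1 = v n.+1 by [].
by elim: n => [|n [IHn IHn1]]; split=> //; rewrite uS vS IHn IHn1.
Qed.

Lemma chebyshevT_rec (R : comNzRingType) (x : R) (n : nat) :
  (chebyshevT R n.+2).[x]
  = 2 * x * (chebyshevT R n.+1).[x] - (chebyshevT R n).[x].
Proof.
rewrite -[chebyshevT R n.+2]/(2 * 'X * chebyshevT R n.+1 - chebyshevT R n).
by rewrite hornerD hornerN !hornerM hornerX -(polyC_natr R 2) hornerC.
Qed.

Lemma chebyshevU_rec (R : comNzRingType) (x : R) (n : nat) :
  (chebyshevU R n.+2).[x]
  = 2 * x * (chebyshevU R n.+1).[x] - (chebyshevU R n).[x].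
Proof.
rewrite -[chebyshevU R n.+2]/(2 * 'X * chebyshevU R n.+1 - chebyshevU R n).
by rewrite hornerD hornerN !hornerM hornerX -(polyC_natr R 2) hornerC.
Qed.

Lemma chebyshevU1 (R : comNzRingType) (x : R) : (chebyshevU R 1).[x] = 2 * x.
Proof. by rewrite /= -(polyC_natr R 2) hornerM hornerX hornerC. Qed.

Lemma chebyshevT4E (n : nat) :
  (chebyshevT rat n).[4] = 4 ^+ n * even_binomial_sum (15 / 16) n.
Proof.
move: n; apply: (@eq_two_step_rec rat (fun a b => 2 * 4 * a - b)).
- exact: chebyshevT_rec.
(* Here [1 - q = 1/16], so scaling by [4 ^ n] turns the coefficients [2] and [1/16] into [8] and
   [1]. *)
- by move=> n; rewrite even_binomial_sum_rec !exprS; field.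
- by rewrite /even_binomial_sum !hornerE big_nat1.
- by rewrite /even_binomial_sum !hornerE big_nat_recr //= big_nat1.
Qed.

(** The index is shifted because the odd half vanishes at 0; its values 1 and 2 at indices 1 and 2
    match [U_0(4) = 1] and [U_1(4) = 8]. *)
Lemma chebyshevU4E (n : nat) :
  (chebyshevU rat n).[4] = 4 ^+ n * odd_binomial_sum (15 / 16) n.+1.
Proof.
move: n; apply: (@eq_two_step_rec rat (fun a b => 2 * 4 * a - b)).
- exact: chebyshevU_rec.
- by move=> n; rewrite odd_binomial_sum_rec !exprS; field.
- by rewrite /odd_binomial_sum !hornerE big_nat_recr //= big_nat1.
- by rewrite chebyshevU1 /odd_binomial_sum !big_nat_recr //= big_geq.
Qed.

Theorem corollary11 :
  (forall n : nat, (1 <= n)%N ->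
     (fib (3 * n))%:R =
       2 * (chebyshevT rat (n - 1)).[4]
       - \sum_(1 <= k < (n - 2).+1)
           (4 * (chebyshevT rat (n - 1 - k)).[4] - 2 * (chebyshevT rat (n - 2 - k)).[4])
           * (fib (3 * k))%:R
     /\
     (fib (3 * n))%:R + 4 * (fib (3 * n - 3))%:R =
       2 * (chebyshevU rat (n - 1)).[4]
       - \sum_(1 <= k < (n - 2).+1)
           (4 * (chebyshevU rat (n - 1 - k)).[4] - 2 * (chebyshevU rat (n - 2 - k)).[4])
           * (fib (3 * k))%:R)
  /\
  (forall n : nat,
     (chebyshevT rat n).[4] =
       4 ^+ n * \sum_(0 <= j < (n %/ 2).+1) 'C(n, 2 * j)%:R * (15 / 16) ^+ j
     /\
     (chebyshevU rat n).[4] =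
       4 ^+ n * \sum_(0 <= j < (n %/ 2).+1)
                  'C(n + 1, 2 * j + 1)%:R * (15 / 16) ^+ j).
Proof.
split=> n; last first.
  split.
    by rewrite chebyshevT4E even_binomial_sumE //; lia.
  by rewrite chebyshevU4E odd_binomial_sumE addn1 //; lia.
(* For [n = 1] the subtraction [n - 2] truncates to 0 and both sums are empty. *)
case: n => [//|[|n]] _.
  by rewrite !big_geq //= !hornerE.
rewrite (_ : n.+2 - 2 = n)%N; last by lia.
rewrite (_ : n.+2 - 1 = n.+1)%N; last by lia.
rewrite (_ : 3 * n.+2 - 3 = 3 * n.+1)%N; last by lia.
have recT j : (chebyshevT rat j.+2).[4]
    = 8 * (chebyshevT rat j.+1).[4] - (chebyshevT rat j).[4].
  by rewrite chebyshevT_rec; ring.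
have recU j : (chebyshevU rat j.+2).[4]
    = 8 * (chebyshevU rat j.+1).[4] - (chebyshevU rat j).[4].
  by rewrite chebyshevU_rec; ring.
(* The coefficient [P 1 - 4 * P 0] is [4 - 4 = 0] for [T] and [8 - 4 = 4] for [U], whence the extra
   term in the second identity only. *)
rewrite (fib3_convolution n recT) (fib3_convolution n recU).
rewrite chebyshevU1 [chebyshevT rat 0]/= [chebyshevU rat 0]/= [chebyshevT rat 1]/=.
by rewrite hornerX hornerC; split; ring.
Qed.
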